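(* For every integer $m\ge1$, with $\mathbf x=(x_1,\dots,x_m)$, $$\frac12\left(\prod_{i=1}^m(1+x_i)(1+x_i^2)-\prod_{i=1}^m(1+x_i)(1-x_i^2)\right)=\sum_{\substack{(\lambda'_1,\lambda'_2,\lambda'_3)\trianglelefteq(m^3)\\ \lambda'_2\equiv_2 1}}\mathsf m^{(m)}_\lambda(\mathbf x)=\sum_{\lambda\trianglelefteq(3^m)}\widehat\omega_\epsilon(z,b')\,S^{\mathrm{U}(m)}_\lambda(\mathbf x),$$ where in the first sum $\lambda$ is the partition with transpose $\lambda'=(\lambda'_1,\lambda'_2,\lambda'_3)$, and in the second sum, for each $\lambda$, the transpose is written $\lambda'=(a+2k,b+2k,\epsilon+2k)$ with $k\ge0$, $\epsilon\in\{0,1\}$, $a\ge b\ge\epsilon$, and $z:=a-b$, $b':=b-\epsilon$; here $$\widehat\omega_\epsilon(z,b')=\frac{-\alpha_\epsilon(z,b')\cdot(b',z)+\widehat\beta_\epsilon(z,b')}{4}$$ with $\alpha_\epsilon$ and $\widehat\beta_\epsilon$ as in the context.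
   Context: $m\equiv_k m'$ means $k\mid m-m'$. Partitions may have trailing zeros; $\lambda\trianglelefteq\mu$ means containment of Young diagrams; $\lambda'$ is the transpose of $\lambda$; $(g^m)$ is the partition with $m$ parts equal to $g$. $\mathsf m^{(m)}_\lambda$ is the monomial symmetric polynomial and $S^{\mathrm{U}(m)}_\lambda$ the Schur polynomial in $m$ variables. $(x,y)\cdot(b',z)=xb'+yz$. The functions below depend on residues: the entry in row $r$, column $s$ (numbered from $0$) is the value at $z\equiv r$, $b'\equiv s$, modulo $2$ for $\alpha_\epsilon$ and modulo $4$ for $\widehat\beta_\epsilon$: $$\alpha_0=\begin{pmatrix}(1,1)&(-1,0)\\(0,1)&(0,0)\end{pmatrix},\quad \alpha_1=\begin{pmatrix}(-1,-1)&(1,0)\\(0,-1)&(0,0)\end{pmatrix},$$ $$\widehat\beta_0=\begin{pmatrix}0&3&-2&1\\1&0&-3&0\\-2&-1&-4&1\\-1&0&-1&0\end{pmatrix},\quad \widehat\beta_1=\begin{pmatrix}4&1&2&-1\\3&0&-1&0\\2&-3&0&-1\\1&0&1&0\end{pmatrix}.$$ *)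

(* Defs.v *)
From HB Require Import structures.
From mathcomp Require Import all_boot all_order all_algebra.
From mathcomp Require Export mpoly.

Set Implicit Arguments.
Unset Strict Implicit.
Unset Printing Implicit Defensive.

Import GRing.Theory.
Local Open Scope ring_scope.

(* Partitions are nonincreasing sequences of naturals, trailing zeros allowed.
   The ones whose diagram is contained in (g^n) are the nonincreasing
   n-tuples over 'I_g.+1. *)
Definition parts (n g : nat) (t : n.-tuple 'I_g.+1) : seq nat :=
  [seq val i | i <- t].

Definition is_part (la : seq nat) : bool := sorted geq la.

(* Truncated or padded with zeros to exactly n parts; this is the transpose
   whenever la is a partition with all parts at most n. *)
Definition transpose (n : nat) (la : seq nat) : n.-tuple nat :=
  [tuple count (fun p => j < p)%N la | j < n].

(* The sum of the distinct monomials x^s, s a rearrangement of la;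
   permutations la has no duplicates. *)
Definition monsym (R : nzRingType) (m : nat) (la : m.-tuple nat) : {mpoly R[m]} :=
  \sum_(s <- permutations la) 'X_[[multinom nth 0%N s i | i < m]].

(* Boxes (row, column) of the Young diagram of la, numbered from 0. *)
Definition box (la : seq nat) : finType := {i : 'I_(size la) & 'I_(nth 0%N la i)}.

Definition box_row (la : seq nat) (c : box la) : nat := tag c.
Definition box_col (la : seq nat) (c : box la) : nat := tagged c.

Definition semistandard (m : nat) (la : seq nat) (T : {ffun box la -> 'I_m}) : bool :=
  [forall c, forall d,
     ((box_row c == box_row d) && (box_col c < box_col d)%N ==> (T c <= T d)%N)
  && ((box_col c == box_col d) && (box_row c < box_row d)%N ==> (T c < T d)%N)].

Definition schur (R : nzRingType) (m : nat) (la : seq nat) : {mpoly R[m]} :=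
  \sum_(T : {ffun box la -> 'I_m} | semistandard T) \prod_(c : box la) 'X_(T c).

Definition entry (T : Type) (x0 : T) (M : seq (seq T)) (r s : nat) : T :=
  nth x0 (nth [::] M r) s.

Definition alpha (eps : bool) (z b' : nat) : int * int :=
  entry (0, 0)
    (if eps then [:: [:: (-1, -1); ( 1, 0)];
                     [:: ( 0, -1); ( 0, 0)]]
            else [:: [:: ( 1,  1); (-1, 0)];
                     [:: ( 0,  1); ( 0, 0)]])
    (z %% 2)%N (b' %% 2)%N.

Definition beta (eps : bool) (z b' : nat) : int :=
  entry 0
    (if eps then [:: [:: 4;  1;  2; -1];
                     [:: 3;  0; -1;  0];
                     [:: 2; -3;  0; -1];
                     [:: 1;  0;  1;  0]]
            else [:: [::  0;  3; -2; 1];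
                     [::  1;  0; -3; 0];
                     [:: -2; -1; -4; 1];
                     [:: -1;  0; -1; 0]])
    (z %% 4)%N (b' %% 4)%N.

Definition dot (u : int * int) (x y : nat) : int := u.1 * x%:Z + u.2 * y%:Z.

Definition omega (eps : bool) (z b' : nat) : rat :=
  (- dot (alpha eps z b') b' z + beta eps z b')%:~R / 4%:R.

(* The unique k >= 0, eps in {0, 1} and a >= b >= eps such that
   mu = (a + 2k, b + 2k, eps + 2k), for a partition mu with three parts. *)
Definition mu_k (mu : 3.-tuple nat) : nat := (nth 0%N mu 2)./2.
Definition mu_eps (mu : 3.-tuple nat) : bool := odd (nth 0%N mu 2).
Definition mu_a (mu : 3.-tuple nat) : nat := (nth 0 mu 0 - 2 * mu_k mu)%N.
Definition mu_b (mu : 3.-tuple nat) : nat := (nth 0 mu 1 - 2 * mu_k mu)%N.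

Lemma mu_decomp (mu : 3.-tuple nat) (a b k : nat) (eps : bool) :
  is_part mu ->
  (tval mu = [:: a + 2 * k; b + 2 * k; eps + 2 * k]%N /\ (eps <= b <= a)%N)
  <-> [/\ a = mu_a mu, b = mu_b mu, eps = mu_eps mu & k = mu_k mu].
Proof.
case: mu => [[|x [|y [|w [|? ?]]]] //= sz].
rewrite /is_part /mu_a /mu_b /mu_eps /mu_k /= andbT => /andP[xy yw].
have lw : (2 * w./2 <= w)%N by rewrite mul2n -{2}(odd_double_half w) leq_addl.
have ly := leq_trans lw yw; have lx := leq_trans ly xy.
split=> [[[-> -> ->] _] | [-> -> -> ->]].
  rewrite !mul2n halfD half_double oddD odd_double addbF andbF.
  have e0 : eps./2 = 0%N by case: eps.
  by rewrite e0 !add0n !addnK oddb.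
rewrite !subnK //; split; last by
  rewrite leq_sub2r // andbT leq_subRL // addnC mul2n odd_double_half.
by rewrite mul2n odd_double_half.
Qed.

(* Main.v *)
Require Import Defs.
From mathcomp Require Import all_boot all_order all_algebra.
From mathcomp Require Import ring zify.

(** Both sides are sums over one-variable data.  On the monomial side,
    (1 + x)(1 + x^2) = 1 + x + x^2 + x^3 and
    (1 + x)(1 - x^2) = 1 + x - x^2 - x^3, so half the difference of the two
    products keeps exactly the monomials with an odd number of exponents at
    least 2; for a rearrangement of lambda that number is lambda'_2
    ([sum_monsym]).

    For the Schur side, the dual Cauchy identity in three variables y
    predicts that prod_i prod_(j < 3) (1 + x_i y_j) is the sum of
    s_lambda'(y) s_lambda(x).  The two products are the cases
    y = (1, i, -i) and y = (1, 1, -1), so the coefficients should be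
    (s_lambda'(1, i, -i) - s_lambda'(1, 1, -1)) / 2.  By the bialternant
    formula, made real in the first case and confluent in the second, each of
    these is a 3 x 3 determinant [alternant], divided by its value at the empty
    partition; its entries are periodic mod 4 or affine in lambda', and
    evaluating it on residues gives omega ([omega_residues], [omega_columns]).

    To prove the expansion, write tableaux as words.  A semistandard tableau with
    at most three columns is the same as a word whose k-th letter is the set of
    columns containing the entry k; semistandardness says that every prefix
    has at least as many boxes in column 0 as in column 1, and in column 1 as
    in column 2 ([sum_tableaux]).  So the Schur expansion becomes a sum, over
    ballot words, of a function of the end point ([sum_schur]).  Such a sum
    factors as soon as adding up the function over all one-letter extensions,
    weighted by t to the size of the letter, multiplies it by f(t)
    ([ballot_sum]).  An alternant has this property: each
    of its columns is moved by a fixed matrix M, the sum over all eight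
    letters multiplies it by det(1 + tM), and the letters leaving the Weyl
    chamber contribute nothing because two columns then coincide
    ([alternant_pos_pieri], [alternant_neg_pieri]). *)

Set Implicit Arguments.
Unset Strict Implicit.
Unset Printing Implicit Defensive.

Import GRing.Theory.
Local Open Scope ring_scope.

(** * Ballot words *)

(** A subset of the three columns. *)
Definition letter := (bool * bool * bool)%type.

Definition bit (e : letter) (j : nat) : bool :=
  nth false [:: e.1.1; e.1.2; e.2] j.

Definition weight (e : letter) : nat := (e.1.1 + e.1.2 + e.2)%N.

Definition word (m : nat) := {ffun 'I_m -> letter}.

(** The height of column j after the first k letters.  The index k is a plain
    natural number, so that prefixes and entries can both be used for it. *)
Definition cnt (m : nat) (w : word m) (j k : nat) : nat :=
  (\sum_(i < m | (i < k)%N) bit (w i) j)%N.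

Definition chamber (p q r : nat) : bool := (r <= q <= p)%N.

Definition ballot (m : nat) (w : word m) : bool :=
  [forall k : 'I_m.+1, chamber (cnt w 0 k) (cnt w 1 k) (cnt w 2 k)].

Definition snoc (m : nat) (E : Type) (w : {ffun 'I_m -> E}) (e : E) :
  {ffun 'I_m.+1 -> E} :=
  [ffun k => if unlift ord_max k is Some k' then w k' else e].

Lemma snoc_max m (E : Type) (w : {ffun 'I_m -> E}) e : snoc w e ord_max = e.
Proof. by rewrite ffunE unlift_none. Qed.

Lemma snoc_widen m (E : Type) (w : {ffun 'I_m -> E}) e (k : 'I_m) :
  snoc w e (widen_ord (leqnSn m) k) = w k.
Proof.
have -> : widen_ord (leqnSn m) k = lift ord_max k.
  by apply: val_inj; rewrite /= /bump leqNgt ltn_ord.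
by rewrite ffunE liftK.
Qed.

(** Summing over words by their last letter, as in the induction on the number
    of variables below. *)
Lemma big_snoc (A : nmodType) m (E : finType) (P : pred {ffun 'I_m.+1 -> E})
    (F : {ffun 'I_m.+1 -> E} -> A) :
  \sum_(w | P w) F w =
  \sum_(w : {ffun 'I_m -> E}) \sum_(e | P (snoc w e)) F (snoc w e).
Proof.
rewrite pair_big_dep /=.
apply: (reindex (fun we : {ffun 'I_m -> E} * E => snoc we.1 we.2)).
exists (fun w : {ffun 'I_m.+1 -> E} =>
  ([ffun k : 'I_m => w (widen_ord (leqnSn m) k)], w ord_max)) => [[w e]|w] _.
  congr pair; last exact: snoc_max.
  by apply/ffunP => k; rewrite ffunE snoc_widen.
apply/ffunP => k; case: (unliftP ord_max k) => [k'|] ->; last by rewrite snoc_max.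
rewrite ffunE liftK ffunE; congr (w _).
by apply: val_inj; rewrite /= /bump leqNgt ltn_ord.
Qed.

Lemma cntE m (w : word m) j : cnt w j m = (\sum_(i < m) bit (w i) j)%N.
Proof. by apply: eq_bigl => i; rewrite ltn_ord. Qed.

Lemma cnt_snoc m (w : word m) e j k :
  (k <= m)%N -> cnt (snoc w e) j k = cnt w j k.
Proof.
move=> km; rewrite /cnt [LHS]big_mkcond [RHS]big_mkcond big_ord_recr /=.
rewrite [(m < k)%N]ltnNge km addn0.
by apply: eq_bigr => i _; rewrite snoc_widen.
Qed.

Lemma cnt_snoc_end m (w : word m) e j :
  cnt (snoc w e) j m.+1 = (cnt w j m + bit e j)%N.
Proof.
rewrite !cntE big_ord_recr /= snoc_max; congr addn.
by apply: eq_bigr => i _; rewrite snoc_widen.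
Qed.

Lemma ballot_snoc m (w : word m) e :
  ballot (snoc w e) = ballot w &&
    chamber (cnt w 0 m + bit e 0) (cnt w 1 m + bit e 1) (cnt w 2 m + bit e 2).
Proof.
apply/forallP/andP => [bw|[/forallP bw ch] k].
  split; last by have := bw ord_max; rewrite !cnt_snoc_end.
  apply/forallP => k; have := bw (widen_ord (leqnSn _) k).
  by rewrite /= !cnt_snoc // -ltnS.
have [km|] := leqP k m.
  by have := bw (Ordinal (km : (k < m.+1)%N)); rewrite !cnt_snoc.
move=> mk; have -> : val k = m.+1 by apply/eqP; rewrite eqn_leq mk -ltnS ltn_ord.
by rewrite !cnt_snoc_end.
Qed.

Lemma ballot_end m (w : word m) :
  ballot w -> chamber (cnt w 0 m) (cnt w 1 m) (cnt w 2 m).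
Proof. by move/forallP/(_ ord_max). Qed.

Definition word_monomial (A : comNzRingType) m (x : 'I_m -> A) (w : word m) : A :=
  \prod_(k < m) x k ^+ weight (w k).

(** Reading a word backwards, the hypothesis removes its last letter at the
    price of a factor f; the end point of the empty word is the origin. *)
Lemma ballot_sum (A : comNzRingType) (h : nat -> nat -> nat -> A) (f : A -> A) :
  (forall t p q r, chamber p q r ->
     \sum_(e : letter | chamber (p + bit e 0) (q + bit e 1) (r + bit e 2))
        h (p + bit e 0)%N (q + bit e 1)%N (r + bit e 2)%N * t ^+ weight e
     = h p q r * f t) ->
  forall m (x : 'I_m -> A),
    \sum_(w : word m | ballot w)
        h (cnt w 0 m) (cnt w 1 m) (cnt w 2 m) * word_monomial x w
    = h 0%N 0%N 0%N * \prod_(k < m) f (x k).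
Proof.
move=> hf; elim=> [|m IHm] x.
  rewrite big_ord0 (bigD1 [ffun=> (false, false, false)]) /=; last first.
    by apply/forallP => k; rewrite /cnt !big_ord0.
  rewrite big1 ?addr0 => [|w /andP[_ /eqP[]]]; last by apply/ffunP => -[].
  by rewrite /word_monomial !cntE !big_ord0.
rewrite big_ord_recr mulrA -IHm big_distrl /= big_snoc [RHS]big_mkcond /=.
apply: eq_bigr => w _; case: ifPn => [bw|nbw]; last first.
  by rewrite big1 // => e; rewrite ballot_snoc (negPf nbw).
rewrite mulrAC -hf ?ballot_end // big_distrl /=.
apply: eq_big => [e|e _]; first by rewrite ballot_snoc bw.
rewrite !cnt_snoc_end /word_monomial big_ord_recr /= snoc_max -!mulrA; congr (_ * _).
by rewrite mulrC; congr (_ * _); apply: eq_bigr => k _; rewrite snoc_widen.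
Qed.

(** * Semistandard tableaux as ballot words *)

Lemma leq_cnt m (w : word m) j k k' : (k <= k')%N -> (cnt w j k <= cnt w j k')%N.
Proof.
move=> kk; rewrite /cnt [leqLHS]big_mkcond [leqRHS]big_mkcond /=.
by apply: leq_sum => i _; case: ifP => // ik; rewrite (leq_trans ik kk).
Qed.

Lemma cntS m (w : word m) j (k : 'I_m) :
  cnt w j k.+1 = (cnt w j k + bit (w k) j)%N.
Proof.
rewrite /cnt (bigD1 k) //= addnC; congr (_ + _)%N.
by apply: eq_bigl => i; rewrite ltnS -val_eqE [RHS]ltn_neqAle /= andbC.
Qed.

Lemma ltn_cnt m (w : word m) j (k k' : 'I_m) :
  bit (w k) j -> (k < k')%N -> (cnt w j k < cnt w j k')%N.
Proof.
by move=> b kk; apply: leq_trans (leq_cnt w j kk); rewrite cntS b addn1.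
Qed.

(** Heights start at 0 and grow by at most 1 per letter, so each value below the
    final one is left at some letter: the (i+1)-st occurrence of column j. *)
Lemma cnt_letter m (w : word m) j i : (i < cnt w j m)%N ->
  exists2 k : 'I_m, bit (w k) j & cnt w j k = i.
Proof.
move=> iw; have ex : exists k, (i < cnt w j k)%N by exists m.
case: (ex_minnP ex) => [[|k] ik mink]; first by move: ik; rewrite /cnt big_pred0.
have km : (k < m)%N by rewrite mink.
have := ik; rewrite -[k]/(val (Ordinal km)) cntS /=.
have : (cnt w j k <= i)%N by rewrite leqNgt; apply/negP => /mink; rewrite ltnn.
case b: (bit _ _) => /= le lt; last by move: lt; rewrite addn0 ltnNge le.
by exists (Ordinal km) => //=; apply/eqP; rewrite eqn_leq le /=; rewrite addn1 in lt.
Qed.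

Lemma ballot_le m (w : word m) j j' k : ballot w -> (j <= j' < 3)%N -> (k <= m)%N ->
  (cnt w j' k <= cnt w j k)%N.
Proof.
move=> /forallP bw jj km.
have /andP[/= h2 h1] := bw (Ordinal (km : k < m.+1)%N).
case/andP: jj; case: j' => [|[|[|]]] //; case: j => [|[|[|]]] // _ _.
exact: leq_trans h2 h1.
Qed.

Section Tableaux.
(* p is the transpose of la, characterized by la_p: the box (i, j) lies in the
   diagram exactly when i < p j. *)
Variables (m : nat) (la : seq nat) (p : nat -> nat).
Hypothesis size_la : size la = m.
Hypothesis la3 : forall i, (nth 0%N la i <= 3)%N.
Hypothesis pm : forall j, (p j <= m)%N.
Hypothesis la_p : forall i j, (i < m)%N -> (j < nth 0%N la i)%N = (i < p j)%N.

Implicit Types (c d : box la) (T : {ffun box la -> 'I_m}).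

Lemma box_row_lt c : (box_row c < m)%N.
Proof. by rewrite -size_la ltn_ord. Qed.

Lemma box_col_lt c : (box_col c < 3)%N.
Proof. by apply: leq_trans (la3 _); apply: ltn_ord. Qed.

Lemma box_lt c : (box_row c < p (box_col c))%N.
Proof. by rewrite -la_p ?box_row_lt //; apply: ltn_ord. Qed.

Lemma boxP i j : (i < p j)%N -> exists2 c : box la, box_row c = i & box_col c = j.
Proof.
move=> ip; have im := leq_trans ip (pm j).
have im' : (i < size la)%N by rewrite size_la.
have ij : (j < nth 0%N la (Ordinal im'))%N by rewrite /= la_p.
by exists (Tagged (fun i : 'I_(size la) => 'I_(nth 0%N la i)) (Ordinal ij)).
Qed.

Lemma box_inj c d : box_row c = box_row d -> box_col c = box_col d -> c = d.
Proof.
case: c d => [i u] [i' u']; rewrite /box_row /box_col /= => /val_inj ii.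
by rewrite -{}ii in u' *; move=> /val_inj ->.
Qed.

Lemma column_row_inj j (P : pred (box la)) :
  {in [pred c | (box_col c == j) && P c] &,
    injective (fun c => Ordinal (box_row_lt c))}.
Proof.
move=> c d; rewrite !inE => /andP[/eqP cj _] /andP[/eqP dj _] [rr].
by apply: box_inj => //; rewrite cj.
Qed.

Definition word_of T : word m :=
  [ffun k => let b j := [exists c : box la, (box_col c == j) && (T c == k)] in
             (b 0%N, b 1%N, b 2%N)].

Lemma bit_word_of T k j :
  bit (word_of T k) j = [exists c : box la, (box_col c == j) && (T c == k)].
Proof.
rewrite ffunE; case: j => [|[|[|j]]] //; rewrite /bit /= nth_nil; apply/esym/existsP.
by case=> c /andP[/eqP cj _]; have := box_col_lt c; rewrite cj.
Qed.

Lemma card_column j i : (i <= p j)%N ->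
  #|[pred c : box la | (box_col c == j) && (box_row c < i)%N]| = i.
Proof.
move=> ip; have im := leq_trans ip (pm j).
rewrite -(card_in_imset (@column_row_inj _ _)).
rewrite -[RHS]card_ord -(card_imset _ (f := widen_ord im)); last first.
  by move=> u v /(congr1 val) /= /val_inj.
apply: eq_card => u; apply/imsetP/imsetP => [[c]|[v _ ->]].
  rewrite inE => /andP[_ ci] ->; exists (Ordinal ci) => //; exact: val_inj.
have [c cv cj] := boxP (leq_trans (ltn_ord v) ip).
by exists c; rewrite ?inE ?cj ?cv ?eqxx ?ltn_ord //; apply: val_inj.
Qed.

Lemma le_p j j' : (j <= j')%N -> (p j' <= p j)%N.
Proof.
move=> jj; rewrite leqNgt; apply/negP => lt.
have im := leq_trans lt (pm _).
by move: (lt); rewrite -la_p // => /(leq_ltn_trans jj); rewrite la_p // ltnn.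
Qed.

Section Fixed.
Variable T : {ffun box la -> 'I_m}.
Hypothesis ssT : semistandard T.

Lemma ss_col c d : box_col c = box_col d -> (box_row c < box_row d)%N -> (T c < T d)%N.
Proof.
move=> cd rr; have /forallP/(_ c)/forallP/(_ d)/andP[_ /implyP] := ssT.
by apply; rewrite cd eqxx.
Qed.

Lemma ss_row c d : box_row c = box_row d -> (box_col c < box_col d)%N -> (T c <= T d)%N.
Proof.
move=> cd rr; have /forallP/(_ c)/forallP/(_ d)/andP[/implyP + _] := ssT.
by apply; rewrite cd eqxx.
Qed.

Lemma ss_col_lt c d : box_col c = box_col d ->
  (T c < T d)%N = (box_row c < box_row d)%N.
Proof.
move=> cd; apply/idP/idP; last exact: ss_col.
apply: contraTT; rewrite -!leqNgt leq_eqVlt => /orP[/eqP rr|/ss_col lt].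
  by rewrite (box_inj (esym rr) cd).
by rewrite ltnW // lt.
Qed.

Lemma ss_col_inj c d : box_col c = box_col d -> T c = T d -> c = d.
Proof.
move=> cd Tcd; apply: box_inj => //.
case: (ltngtP (box_row c) (box_row d)) => // lt.
  by have := ss_col cd lt; rewrite Tcd ltnn.
by have := ss_col (esym cd) lt; rewrite Tcd ltnn.
Qed.

(** Entries are distinct within a column, so letters of the word correspond to
    boxes. *)
Lemma cnt_word_of j k :
  cnt (word_of T) j k = #|[pred c : box la | (box_col c == j) && (T c < k)%N]|.
Proof.
rewrite -(card_in_imset (f := T)); last first.
  move=> c d; rewrite !inE => /andP[/eqP cj _] /andP[/eqP dj _].
  by apply: ss_col_inj; rewrite cj.
rewrite -sum1_card /cnt big_mkcond [RHS]big_mkcond; apply: eq_bigr => i _.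
rewrite bit_word_of; symmetry; case: imsetP => [[c]|nex].
  rewrite inE => /andP[/eqP cj Tc] ->; rewrite Tc.
  by case: existsP => // -[]; exists c; rewrite cj !eqxx.
case: ifP => // ik; case: existsP => // -[c /andP[cj /eqP Tc]].
by case: nex; exists c; rewrite // inE cj Tc.
Qed.

(** This recovers a tableau from its word: the row of a box is the number of
    smaller entries in its column. *)
Lemma cnt_word_of_row c : cnt (word_of T) (box_col c) (T c) = box_row c.
Proof.
rewrite cnt_word_of -[RHS](card_column (ltnW (box_lt c))); apply: eq_card => d.
by rewrite !inE; case: eqP => //= dc; rewrite ss_col_lt.
Qed.

Lemma cnt_word_of_end j : cnt (word_of T) j m = p j.
Proof.
rewrite cnt_word_of -[RHS](card_column (leqnn (p j))); apply: eq_card => d.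
by rewrite !inE ltn_ord; case: eqP => //= <-; rewrite box_lt.
Qed.

(** Rows increase weakly, so moving left from column j' to column j keeps an
    entry smaller than k. *)
Lemma cnt_word_of_le j j' k : (j <= j')%N ->
  (cnt (word_of T) j' k <= cnt (word_of T) j k)%N.
Proof.
rewrite leq_eqVlt => /orP[/eqP -> //|jj]; rewrite !cnt_word_of.
rewrite -(card_in_imset (@column_row_inj _ _)).
rewrite -[leqRHS](card_in_imset (@column_row_inj _ _)).
apply: subset_leq_card; apply/subsetP => u /imsetP[d].
rewrite inE => /andP[/eqP dj Td] ->.
have [c cd cj] : exists2 c : box la, box_row c = box_row d & box_col c = j.
  by apply: boxP; apply: leq_trans (le_p (ltnW jj)); rewrite -dj box_lt.
apply/imsetP; exists c; last exact: val_inj.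
by rewrite inE cj eqxx; apply: leq_ltn_trans Td; rewrite ss_row // cj dj.
Qed.

Lemma ballot_word_of : ballot (word_of T).
Proof. by apply/forallP => k; rewrite /chamber !cnt_word_of_le. Qed.

Lemma word_monomial_word_of (A : comNzRingType) (x : 'I_m -> A) :
  word_monomial x (word_of T) = \prod_c x (T c).
Proof.
rewrite (partition_big T predT) //=; apply: eq_bigr => k _.
transitivity (x k ^+ #|[pred c | T c == k]|); last first.
  by rewrite -prodr_const; apply: eq_big => // c /eqP ->.
congr (_ ^+ _).
rewrite -(card_in_imset (f := fun c : box la => Ordinal (box_col_lt c))); last first.
  move=> c d; rewrite !inE => /eqP cj /eqP dj [rr].
  by apply: ss_col_inj; rewrite // cj.
rewrite -sum1_card big_mkcond !big_ord_recl big_ord0 /= addn0 /weight addnA.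
rewrite -[(_.1.1 : bool)]/(bit _ 0) -[(_.1.2 : bool)]/(bit _ 1) -[(_.2 : bool)]/(bit _ 2).
rewrite !bit_word_of.
have imE (j : 'I_3) : [exists c : box la, (box_col c == j) && (T c == k)]
    = (j \in [set Ordinal (box_col_lt c) | c in [pred c : box la | T c == k]]).
  apply/existsP/imsetP => [[c /andP[/eqP cj Tc]]|[c + ->]].
    by exists c; rewrite ?inE //; apply: val_inj.
  by rewrite inE => Tc; exists c; rewrite eqxx.
rewrite (imE ord0) (imE (lift ord0 ord0)) (imE (lift ord0 (lift ord0 ord0))).
by do 3 case: (_ \in _).
Qed.
End Fixed.

(** The entry at row i of column j must be the letter where column j has height
    i and grows, and there is only one such letter. *)
Lemma word_of_inj : {in [pred T | semistandard T] &, injective word_of}.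
Proof.
move=> T U; rewrite !inE => sT sU TU; apply/ffunP => c; apply: val_inj.
have bT : bit (word_of T (T c)) (box_col c).
  by rewrite bit_word_of; apply/existsP; exists c; rewrite !eqxx.
have bU : bit (word_of T (U c)) (box_col c).
  by rewrite TU bit_word_of; apply/existsP; exists c; rewrite !eqxx.
have := cnt_word_of_row sU c; rewrite -TU -[RHS](cnt_word_of_row sT) => e.
case: (ltngtP (T c) (U c)) => // lt.
  by have := ltn_cnt bT lt; rewrite e ltnn.
by have := ltn_cnt bU lt; rewrite e ltnn.
Qed.

(** The tableau puts into box (i, j) the letter at which column j grows past
    height i.  Columns increase because heights do; a descent along a row would
    be a prefix in which the right column is higher than the left one. *)
Lemma word_of_surj (w : word m) : ballot w -> (forall j, cnt w j m = p j) ->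
  exists2 T, semistandard T & word_of T = w.
Proof.
move=> bw wp.
have ex c : exists k : 'I_m, bit (w k) (box_col c) && (cnt w (box_col c) k == box_row c).
  have := box_lt c; rewrite -wp => /cnt_letter[k bk ck].
  by exists k; rewrite bk ck eqxx.
pose T := [ffun c => xchoose (ex c)].
have Tb c : bit (w (T c)) (box_col c).
  by rewrite ffunE; case/andP: (xchooseP (ex c)).
have Tc c : cnt w (box_col c) (T c) = box_row c.
  by rewrite ffunE; case/andP: (xchooseP (ex c)) => _ /eqP.
exists T.
  apply/forallP => c; apply/forallP => d; apply/andP; split; apply/implyP.
    case/andP=> /eqP rr cc; rewrite leqNgt; apply/negP => lt.
    (* if T d < T c, then after the letter T d the column of d has height
       row + 1 while that of c is at most at height row *)
    have : (cnt w (box_col d) (T d).+1 <= cnt w (box_col c) (T c))%N.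
      apply: leq_trans (leq_cnt w _ lt); apply: ballot_le => //.
      by rewrite ltnW // box_col_lt.
    by rewrite cntS Tb Tc Tc rr addn1 ltnn.
  case/andP=> /eqP cc; apply: contraTT; rewrite -!leqNgt -!Tc cc.
  exact: leq_cnt.
apply/ffunP => k.
suff bE j : bit (word_of T k) j = bit (w k) j.
  have := (bE 0%N, bE 1%N, bE 2%N).
  rewrite /bit /=; case: (word_of T k) => [[? ?] ?]; case: (w k) => [[? ?] ?] /=.
  by case=> [[-> ->] ->].
rewrite bit_word_of; apply/existsP/idP => [[c /andP[/eqP <- /eqP <-]]|bk]; first exact: Tb.
have : (cnt w j k < p j)%N.
  by rewrite -wp; apply: leq_trans (leq_cnt w j (ltn_ord k)); rewrite cntS bk addn1.
case/boxP => c cr cj; exists c; rewrite cj eqxx; apply/eqP/val_inj => /=.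
have := Tc c; have := Tb c; rewrite cj cr => bT e.
case: (ltngtP (T c) k) => // lt.
  by have := ltn_cnt bT lt; rewrite e ltnn.
by have := ltn_cnt bk lt; rewrite e ltnn.
Qed.

Lemma sum_tableaux (A : comNzRingType) (x : 'I_m -> A) :
  \sum_(T : {ffun box la -> 'I_m} | semistandard T) \prod_c x (T c) =
  \sum_(w : word m | ballot w && [forall j : 'I_3, cnt w j m == p j]) word_monomial x w.
Proof.
under eq_bigr => T ssT do rewrite -word_monomial_word_of //.
rewrite -(big_imset (fun w => word_monomial x w) word_of_inj) /=; apply: eq_bigl => w.
apply/imsetP/andP => [[T ssT ->]|[bw /forallP we]].
  split; first exact: ballot_word_of.
  by apply/forallP => j; rewrite cnt_word_of_end.
have [|T ssT <-] := word_of_surj bw; last by exists T.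
case=> [|[|[|j]]].
- by have /eqP := we ord0.
- by have /eqP := we (lift ord0 ord0).
- by have /eqP := we (lift ord0 (lift ord0 ord0)).
have -> : p j.+3 = 0%N.
  apply/eqP; rewrite -leqn0 leqNgt; apply/negP => lt.
  have [c _ cj] := boxP lt; by have := box_col_lt c; rewrite cj.
by rewrite cntE big1 // => i _; rewrite /bit /= nth_nil.
Qed.
End Tableaux.

(** * Shapes and their transposes *)

(** Both sides say that the box (i, j) lies in the diagram of s. *)
Lemma ltn_nth_count s i j : is_part s -> (i < size s)%N ->
  (j < nth 0%N s i)%N = (i < count (fun v => j < v)%N s)%N.
Proof.
rewrite /is_part; elim: s i => // x s IHs i sx /=.
have le_x v : v \in s -> (v <= x)%N.
  move: sx => /=; rewrite path_sortedE => [/andP[/allP le _] /le //|y a b ab bc].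
  exact: leq_trans bc ab.
case: (ltnP j x) => jx.
  by case: i => [|i] //= lt; rewrite add1n ltnS IHs // (path_sorted sx).
have -> : count (fun v => j < v)%N s = 0%N.
  apply/eqP; rewrite -leqn0 leqNgt -has_count; apply/hasPn => v vs; rewrite -leqNgt.
  exact: leq_trans (le_x _ vs) jx.
case: i => [|i] lt; apply/negbTE; rewrite -leqNgt //=.
by rewrite (leq_trans _ jx) // le_x // mem_nth.
Qed.

Lemma size_parts n g (t : n.-tuple 'I_g.+1) : size (parts t) = n.
Proof. by rewrite size_map size_tuple. Qed.

Lemma nth_parts n g (t : n.-tuple 'I_g.+1) (i : 'I_n) :
  nth 0%N (parts t) i = tnth t i.
Proof. by rewrite (nth_map (tnth t i)) ?size_tuple // -tnth_nth. Qed.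

Lemma nth_transpose n s j : (j < n)%N ->
  nth 0%N (transpose n s) j = count (fun v => j < v)%N s.
Proof.
by move=> jn; rewrite -[j]/(val (Ordinal jn)) -tnth_nth tnth_mktuple.
Qed.

Lemma count_parts n g (t : n.-tuple 'I_g.+1) (P : pred nat) :
  count P (parts t) = (\sum_(i < n) P (tnth t i))%N.
Proof.
rewrite -sum1_count big_mkcond big_map big_tuple; apply: eq_bigr => i _.
by case: (P _).
Qed.

Lemma sum_ltn_ord n k : (k <= n)%N -> (\sum_(i < n) (i < k))%N = k.
Proof.
move=> kn; rewrite -[RHS]card_ord -sum1_card (big_ord_widen n (fun=> 1%N) kn).
by rewrite [RHS]big_mkcond; apply: eq_bigr => i _; case: ltnP.
Qed.

(** The transpose of the end point of w: row i has a box in each column higher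
    than i. *)
Definition shape m (w : word m) : m.-tuple 'I_4 :=
  [tuple inord (\sum_(j < 3) (i < cnt w j m)) | i < m].

Lemma cnt_le m (w : word m) j : (cnt w j m <= m)%N.
Proof.
rewrite cntE -[leqRHS]card_ord -sum1_card; apply: leq_sum => i _.
by case: bit.
Qed.

Lemma tnth_shape m (w : word m) i :
  val (tnth (shape w) i) = (\sum_(j < 3) (i < cnt w j m))%N.
Proof.
rewrite tnth_mktuple /= inordK // ltnS -[leqRHS]card_ord -sum1_card.
by apply: leq_sum => j _; case: (_ < _)%N.
Qed.

Lemma shape_part m (w : word m) : is_part (parts (shape w)).
Proof.
apply/(sortedP 0%N) => i; rewrite size_parts => im /=.
have im' := ltnW im.
rewrite (nth_parts (shape w) (Ordinal im)) (nth_parts (shape w) (Ordinal im')).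
rewrite !tnth_shape; apply: leq_sum => j _ /=.
by case: ltnP => // /ltnW ->.
Qed.

Lemma shape_eq m (w : word m) (la : m.-tuple 'I_4) :
  ballot w -> is_part (parts la) ->
  (shape w == la) = [forall j : 'I_3, cnt w j m == count (fun v => j < v)%N (parts la)].
Proof.
move=> bw lap; apply/eqP/forallP => [<- j|wj].
  rewrite count_parts -{1}(sum_ltn_ord (cnt_le w j)); apply/eqP/eq_bigr => i _.
  congr nat_of_bool; rewrite tnth_shape.
  have := ballot_le (k := m) bw; rewrite !big_ord_recl big_ord0 /= => le.
  have le01 := le 0%N 1%N isT (leqnn _); have le12 := le 1%N 2%N isT (leqnn _).
  rewrite -[bump 0 (bump 0 0)]/2%N -[bump 0 0]/1%N.
  case: j => -[|[|[|]]] //= _; do 3 case: ltnP; lia.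
apply: eq_from_tnth => i; apply: val_inj; rewrite tnth_shape.
have lt3 : (tnth la i <= 3)%N by rewrite -ltnS.
rewrite -[RHS](sum_ltn_ord lt3); apply: eq_bigr => j _; congr nat_of_bool.
by rewrite (eqP (wj j)) -ltn_nth_count ?size_parts // nth_parts.
Qed.

(** Grouping ballot words by their shape turns the sum over partitions and
    tableaux into a single sum over words. *)
Lemma sum_schur (m : nat) (h : nat -> nat -> nat -> rat) :
  \sum_(la : m.-tuple 'I_4 | is_part (parts la))
     (let mu := transpose 3 (parts la) in
      h (nth 0%N mu 0) (nth 0%N mu 1) (nth 0%N mu 2) *: schur rat m (parts la))
  = \sum_(w : word m | ballot w)
      h (cnt w 0 m) (cnt w 1 m) (cnt w 2 m) *: word_monomial (fun i => 'X_i) w.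
Proof.
rewrite [RHS](partition_big (@shape m) (fun la => is_part (parts la))) /=; last first.
  by move=> w _; apply: shape_part.
apply: eq_bigr => la lap.
pose p j := count (fun v => j < v)%N (parts la).
have la3 i : (nth 0%N (parts la) i <= 3)%N.
  case: (ltnP i m) => im; last by rewrite nth_default ?size_parts.
  by rewrite (nth_parts la (Ordinal im)) -ltnS.
have pm j : (p j <= m)%N by rewrite -[leqRHS](size_parts la) count_size.
have la_p i j : (i < m)%N -> (j < nth 0%N (parts la) i)%N = (i < p j)%N.
  by move=> im; rewrite ltn_nth_count ?size_parts.
rewrite !nth_transpose // /schur.
rewrite (sum_tableaux (size_parts la) la3 pm la_p (fun i => 'X_i)) scaler_sumr.
apply: eq_big => [w|w /andP[_ /forallP wp]].
  by case: (boolP (ballot w)) => //= bw; rewrite shape_eq.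
by rewrite (eqP (wp ord0)) (eqP (wp (lift ord0 ord0))) (eqP (wp (lift ord0 (lift ord0 ord0)))).
Qed.

(** * Alternants and their Pieri rule *)

Section Alternants.
Variable A : comNzRingType.

(** The 3 x 3 determinant with rows 1, u, v and columns indexed by
    (p, q, r) + (2, 1, 0): the numerator of a bialternant
    formula. *)
Definition alternant (u v : nat -> A) (p q r : nat) : A :=
  let l0 := p.+2 in let l1 := q.+1 in let l2 := r in
  (u l1 * v l2 - v l1 * u l2) - (u l0 * v l2 - v l0 * u l2)
  + (u l0 * v l1 - v l0 * u l1).

(** Real and imaginary parts of the n-th power of the imaginary unit. *)
Definition re4 (n : nat) : A := if odd n then 0 else (-1) ^+ n./2.
Definition im4 (n : nat) : A := if odd n then (-1) ^+ n./2 else 0.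

Lemma re4S n : re4 n.+1 = - im4 n.
Proof.
rewrite /re4 /im4 /= uphalf_half; case: (odd n); rewrite /= ?oppr0 //.
by rewrite add1n exprS mulN1r.
Qed.

Lemma im4S n : im4 n.+1 = re4 n.
Proof. by rewrite /re4 /im4 /= uphalf_half; case: (odd n). Qed.

Definition natr_of (n : nat) : A := n%:R.
Definition altsign (n : nat) : A := (-1) ^+ n.

Lemma natr_ofS n : natr_of n.+1 = 1 + natr_of n.
Proof. exact: mulrS. Qed.

Lemma altsignS n : altsign n.+1 = - altsign n.
Proof. by rewrite /altsign exprS mulN1r. Qed.

(** Two columns coincide one step outside the chamber, so letters leaving the
    chamber may be included in a Pieri sum at no cost. *)
Lemma alternant_wall0 u v p r : alternant u v p p.+1 r = 0.
Proof. rewrite /alternant /=; ring. Qed.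

Lemma alternant_wall1 u v p q : alternant u v p q q.+1 = 0.
Proof. rewrite /alternant /=; ring. Qed.

Lemma sum_letter (F : letter -> A) :
  \sum_e F e = \sum_(a : bool) \sum_(b : bool) \sum_(c : bool) F (a, b, c).
Proof.
rewrite pair_big pair_big /=.
by apply: eq_bigr => -[[a b] c] _.
Qed.

Lemma sum_chamber_alternant (u v : nat -> A) (t : A) p q r : chamber p q r ->
  \sum_(e : letter | chamber (p + bit e 0) (q + bit e 1) (r + bit e 2))
     alternant u v (p + bit e 0) (q + bit e 1) (r + bit e 2) * t ^+ weight e
  = \sum_(e : letter)
     alternant u v (p + bit e 0) (q + bit e 1) (r + bit e 2) * t ^+ weight e.
Proof.
move=> ch; rewrite big_mkcond; apply: eq_bigr => e _; case: ifPn => //= nch.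
suff -> : alternant u v (p + bit e 0) (q + bit e 1) (r + bit e 2) = 0 by rewrite mul0r.
move: ch nch; rewrite /chamber negb_and -!ltnNge => /andP[rq qp] /orP[lt|lt].
- have -> : (r + bit e 2 = (q + bit e 1).+1)%N by move: lt; do 2 case: (bit e _); lia.
  exact: alternant_wall1.
- have -> : (q + bit e 1 = (p + bit e 0).+1)%N by move: lt; do 2 case: (bit e _); lia.
  exact: alternant_wall0.
Qed.

(** Adding 1 to an index applies diag(1, J) to that column, J the rotation by a
    right angle, and det(1 + t diag(1, J)) = (1 + t)(1 + t^2). *)
Lemma alternant_pos_pieri t p q r : chamber p q r ->
  \sum_(e : letter | chamber (p + bit e 0) (q + bit e 1) (r + bit e 2))
     alternant re4 im4 (p + bit e 0) (q + bit e 1) (r + bit e 2) * t ^+ weight e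
  = alternant re4 im4 p q r * ((1 + t) * (1 + t ^+ 2)).
Proof.
move=> ch; rewrite sum_chamber_alternant // sum_letter !big_bool.
rewrite /bit /weight /alternant /= !addn0 !addn1 !(re4S, im4S); ring.
Qed.

(** Here adding 1 to an index fixes 1, sends n to n + 1 and changes the last
    sign, a matrix with eigenvalues 1, 1, -1, whence the factor
    (1 + t)^2 (1 - t) = (1 + t)(1 - t^2). *)
Lemma alternant_neg_pieri t p q r : chamber p q r ->
  \sum_(e : letter | chamber (p + bit e 0) (q + bit e 1) (r + bit e 2))
     alternant natr_of altsign (p + bit e 0) (q + bit e 1) (r + bit e 2) * t ^+ weight e
  = alternant natr_of altsign p q r * ((1 + t) * (1 - t ^+ 2)).
Proof.
move=> ch; rewrite sum_chamber_alternant // sum_letter !big_bool.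
rewrite /bit /weight /alternant /= !addn0 !addn1 !(natr_ofS, altsignS); ring.
Qed.
End Alternants.

Lemma re4_add4 (A : comNzRingType) n B : re4 A (4 * B + n) = re4 A n.
Proof. by elim: B => // B IH; rewrite mulnS -addnA !(re4S, im4S) !opprK. Qed.

Lemma im4_add4 (A : comNzRingType) n B : im4 A (4 * B + n) = im4 A n.
Proof. by elim: B => // B IH; rewrite mulnS -addnA !(re4S, im4S) !opprK. Qed.

Lemma altsign_add4 (A : comNzRingType) n B : altsign A (4 * B + n) = altsign A n.
Proof. by rewrite /altsign exprD exprM -signr_odd expr0 expr1n mul1r. Qed.

(** A shift by 2 acts on the columns by a matrix of determinant 1; this is why
    omega does not depend on k. *)
Lemma alternant_pos_shift (A : comNzRingType) p q r k :
  alternant (re4 A) (im4 A) (p + 2 * k) (q + 2 * k) (r + 2 * k)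
  = alternant (re4 A) (im4 A) p q r.
Proof.
elim: k => [|k IH]; first by rewrite !addn0.
rewrite -{}IH mulnS !(addnCA _ 2%N) /alternant /= !(re4S, im4S); ring.
Qed.

Lemma alternant_neg_shift (A : comNzRingType) p q r k :
  alternant (natr_of A) (altsign A) (p + 2 * k) (q + 2 * k) (r + 2 * k)
  = alternant (natr_of A) (altsign A) p q r.
Proof.
elim: k => [|k IH]; first by rewrite !addn0.
rewrite -{}IH mulnS !(addnCA _ 2%N) /alternant /= !(natr_ofS, altsignS); ring.
Qed.

(** All terms are periodic mod 4 or affine, so the identity is checked for each
    eps and each pair of residues of z and b mod 4. *)
Lemma omega_residues (eps : bool) z b :
  8%:R * omega eps z b
  = alternant (natr_of rat) (altsign rat) (eps + b + z) (eps + b) eps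
    - 2%:R * alternant (re4 rat) (im4 rat) (eps + b + z) (eps + b) eps.
Proof.
have split4 n : exists N, exists2 i, (i < 4)%N & n = (4 * N + i)%N.
  by exists (n %/ 4)%N, (n %% 4)%N; rewrite ?ltn_pmod // mulnC -divn_eq.
have [Z [y ly ->]] := split4 z; have [B [c lc ->]] := split4 b.
rewrite /omega /dot /alpha /beta.
have mod4 N i : ((4 * N + i) %% 4 = i %% 4)%N by rewrite mulnC modnMDl.
have mod2 N i : ((4 * N + i) %% 2 = i %% 2)%N.
  by rewrite -[4%N]/(2 * 2)%N -mulnA mulnC modnMDl.
rewrite !mod4 !mod2 /alternant.
have -> : ((eps + (4 * B + c) + (4 * Z + y)).+2 = 4 * (B + Z) + (eps + c + y).+2)%N by lia.
have -> : ((eps + (4 * B + c)).+1 = 4 * B + (eps + c).+1)%N by lia.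
rewrite !(re4_add4, im4_add4, altsign_add4) /natr_of /re4 /im4 /altsign.
rewrite !(natrD, natrM, PoszD, PoszM).
rewrite !(rmorphD, rmorphN, rmorphM) /=.
rewrite -!pmulrn.
case: eps; case: y ly => [|[|[|[|]]]] // _; case: c lc => [|[|[|[|]]]] // _;
  rewrite /entry /=; by field.
Qed.

(** * The Schur expansion *)

Lemma rmorph_alternant (A B : comNzRingType) (f : {rmorphism A -> B}) u v u' v' p q r :
  (forall n, f (u n) = u' n) -> (forall n, f (v n) = v' n) ->
  f (alternant u v p q r) = alternant u' v' p q r.
Proof. by move=> fu fv; rewrite /alternant /= !(rmorphD, rmorphN, rmorphM) /= !fu !fv. Qed.

(** The alternants at the empty partition are -2 (for re4, im4) and -4 (for
    natr_of, altsign); the half difference of the two normalized alternants is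
    (pos / -2 - neg / -4) / 2 = (neg - 2 pos) / 8. *)
Definition omega_alternant (p q r : nat) : rat :=
  8%:R^-1 * (alternant (natr_of rat) (altsign rat) p q r
             - 2%:R * alternant (re4 rat) (im4 rat) p q r).

Lemma omega_columns (mu : 3.-tuple nat) :
  chamber (nth 0%N mu 0) (nth 0%N mu 1) (nth 0%N mu 2) ->
  omega (mu_eps mu) (mu_a mu - mu_b mu) (mu_b mu - mu_eps mu)
  = omega_alternant (nth 0%N mu 0) (nth 0%N mu 1) (nth 0%N mu 2).
Proof.
rewrite /omega_alternant => ch; apply: (mulfI (isT : 8%:R != 0 :> rat)).
rewrite mulVKf // omega_residues /mu_a /mu_b /mu_eps /mu_k.
move: (nth 0%N mu 0) (nth 0%N mu 1) (nth 0%N mu 2) ch => p q r /andP[rq qp].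
have -> : (odd r + (q - 2 * r./2 - odd r) = q - 2 * r./2)%N by lia.
have -> : (q - 2 * r./2 + (p - 2 * r./2 - (q - 2 * r./2)) = p - 2 * r./2)%N by lia.
rewrite -(alternant_pos_shift _ _ _ _ r./2) -(alternant_neg_shift _ _ _ _ r./2).
have -> : (q - 2 * r./2 + 2 * r./2 = q)%N by lia.
have -> : (p - 2 * r./2 + 2 * r./2 = p)%N by lia.
by have -> : (odd r + 2 * r./2 = r)%N by lia.
Qed.

Lemma sum_omega_schur m :
  \sum_(la : m.-tuple 'I_4 | is_part (parts la))
        (let mu := transpose 3 (parts la) in
         let eps := mu_eps mu in
         let z := (mu_a mu - mu_b mu)%N in
         let b' := (mu_b mu - eps)%N in
         omega eps z b' *: schur rat m (parts la))
  = 2%:R^-1 *: (\prod_(i < m) ((1 + 'X_i) * (1 + 'X_i ^+ 2))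
                - \prod_(i < m) ((1 + 'X_i) * (1 - 'X_i ^+ 2))).
Proof.
transitivity (\sum_(la : m.-tuple 'I_4 | is_part (parts la))
   (let mu := transpose 3 (parts la) in
    omega_alternant (nth 0%N mu 0) (nth 0%N mu 1) (nth 0%N mu 2)
      *: schur rat m (parts la))).
  apply: eq_bigr => la _ /=; congr (_ *: _); apply: omega_columns.
  rewrite !nth_transpose // /chamber; apply/andP; split;
    by apply: sub_count => v /=; lia.
rewrite sum_schur; apply: (@scalerI _ _ (8%:R : rat)); first by [].
have pos := ballot_sum (@alternant_pos_pieri _) (fun i : 'I_m => 'X_i : {mpoly rat[m]}).
have neg := ballot_sum (@alternant_neg_pieri _) (fun i : 'I_m => 'X_i : {mpoly rat[m]}).
have pos0 : alternant (re4 {mpoly rat[m]}) (im4 _) 0 0 0 = - 2%:R.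
  by rewrite /alternant /re4 /im4 /=; ring.
have neg0 : alternant (natr_of {mpoly rat[m]}) (altsign _) 0 0 0 = - 4%:R.
  by rewrite /alternant /natr_of /altsign /=; ring.
rewrite pos0 in pos; rewrite neg0 in neg.
rewrite scalerA (_ : 8%:R / 2%:R = 4%:R :> rat) // -!mul_mpolyC mulr_sumr.
transitivity (\sum_(w : word m | ballot w)
  (alternant (natr_of {mpoly rat[m]}) (altsign _) (cnt w 0 m) (cnt w 1 m) (cnt w 2 m)
     * word_monomial (fun i => 'X_i) w
   - 2%:R * (alternant (re4 {mpoly rat[m]}) (im4 _) (cnt w 0 m) (cnt w 1 m) (cnt w 2 m)
     * word_monomial (fun i => 'X_i) w))).
  apply: eq_bigr => w _; rewrite -mul_mpolyC [LHS]mulrA -rmorphM /omega_alternant mulVKf //.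
  rewrite [X in _ = _ - X]mulrA -mulrBl; congr (_ * _); rewrite rmorphB rmorphM /= rmorph_nat.
  congr (_ - _ * _); apply: rmorph_alternant => n.
  - exact: rmorph_nat.
  - exact: rmorph_sign.
  - by rewrite /re4; case: odd; rewrite ?rmorph0 ?rmorph_sign.
  - by rewrite /im4; case: odd; rewrite ?rmorph0 ?rmorph_sign.
rewrite sumrB -mulr_sumr neg pos rmorph_nat; ring.
Qed.

(** * The monomial expansion *)

(** Multiplicities are differences of consecutive threshold counts, and that of
    0 is determined by the size. *)
Lemma perm_count_gt (s t : seq nat) : size s = size t ->
  (forall j, count (fun v => j < v)%N s = count (fun v => j < v)%N t) ->
  perm_eq s t.
Proof.
move=> st gt; apply/allP => x _; apply/eqP; case: x => [|x].
  have split0 r : (count_mem 0%N r + count (fun v => 0 < v)%N r = size r)%N.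
    by rewrite -(count_predC (pred1 0%N) r); congr addn; apply: eq_count => -[].
  by apply/(@addIn (count (fun v => 0 < v)%N s)); rewrite split0 gt split0.
have splitS r : (count_mem x.+1 r + count (fun v => x.+1 < v)%N r
                 = count (fun v => x < v)%N r)%N.
  rewrite -count_predUI [X in (_ + X)%N](@eq_count _ _ pred0) => [|v /=]; last first.
    by case: eqP => //= ->; rewrite ltnn.
  by rewrite count_pred0 addn0; apply: eq_count => v /=; rewrite [RHS]leq_eqVlt eq_sym.
by apply/(@addIn (count (fun v => x.+1 < v)%N s)); rewrite splitS (gt x) (gt x.+1) splitS.
Qed.

(** The transpose of the partition obtained by sorting the values of f. *)
Definition threshold m (f : {ffun 'I_m -> 'I_4}) : 3.-tuple 'I_m.+1 :=
  [tuple inord (\sum_(i < m) (j < f i)) | j < 3].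

Lemma tnth_threshold m (f : {ffun 'I_m -> 'I_4}) j :
  val (tnth (threshold f) j) = (\sum_(i < m) (j < f i))%N.
Proof.
rewrite tnth_mktuple /= inordK // ltnS -[leqRHS]card_ord -sum1_card.
by apply: leq_sum => i _; case: (_ < _)%N.
Qed.

Lemma threshold_part m (f : {ffun 'I_m -> 'I_4}) : is_part (parts (threshold f)).
Proof.
apply/(sortedP 0%N) => j; rewrite size_parts => j3 /=.
have j3' := ltnW j3.
rewrite (nth_parts (threshold f) (Ordinal j3)) (nth_parts (threshold f) (Ordinal j3')).
rewrite !tnth_threshold; apply: leq_sum => i _ /=.
by case: ltnP => // /ltnW ->.
Qed.

Lemma count_transpose m (mu : 3.-tuple 'I_m.+1) (j : 'I_3) : is_part (parts mu) ->
  count (fun v => j < v)%N (transpose m (parts mu)) = tnth mu j.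
Proof.
move=> mup; rewrite -sum1_count big_mkcond big_tuple /=.
rewrite -[RHS](sum_ltn_ord (n := m)) -1?ltnS //; apply: eq_bigr => i _.
by rewrite tnth_mktuple -ltn_nth_count ?size_parts // nth_parts; case: (_ < _)%N.
Qed.

Definition values m (f : {ffun 'I_m -> 'I_4}) : seq nat := [seq val (f i) | i <- enum 'I_m].

Lemma count_values m (f : {ffun 'I_m -> 'I_4}) (P : pred nat) :
  count P (values f) = (\sum_(i < m) P (f i))%N.
Proof.
rewrite -sum1_count big_mkcond big_map big_enum /=.
by apply: eq_bigr => i _; case: (P _).
Qed.

(** Rearrangements of a partition are the exponent vectors with the same
    threshold counts, so they are found by [threshold] without sorting. *)
Lemma perm_values m (f : {ffun 'I_m -> 'I_4}) (mu : 3.-tuple 'I_m.+1) :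
  is_part (parts mu) ->
  perm_eq (values f) (transpose m (parts mu)) = (threshold f == mu).
Proof.
move=> mup; apply/idP/eqP => [/permP fmu|<-].
  apply: eq_from_tnth => j; apply: val_inj.
  by rewrite tnth_threshold /= -(count_transpose _ mup) -fmu count_values.
apply: perm_count_gt => [|j]; first by rewrite size_map size_enum_ord size_tuple.
case: (ltnP j 3) => j3.
  rewrite (count_transpose (Ordinal j3) (threshold_part f)) tnth_threshold.
  by rewrite count_values.
rewrite count_values big1 => [|i _]; last first.
  by rewrite ltnNge (leq_trans _ j3) // -ltnS.
symmetry; apply/eqP; rewrite -leqn0 leqNgt -has_count; apply/hasPn => v.
case/mapP => i _ ->; rewrite -leqNgt.
by apply: leq_trans (count_size _ _) _; rewrite size_parts.
Qed.

Lemma monsymE m (mu : 3.-tuple 'I_m.+1) : is_part (parts mu) ->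
  monsym rat (transpose m (parts mu)) =
  \sum_(f : {ffun 'I_m -> 'I_4} | threshold f == mu) \prod_(i < m) 'X_i ^+ f i.
Proof.
move=> mup.
have vals_inj : injective (@values m).
  move=> f g /eq_in_map fg; apply/ffunP => i; apply: val_inj.
  by apply: fg; rewrite mem_enum.
have perm_vals : perm_eq [seq values f | f in [pred f : {ffun 'I_m -> 'I_4} | threshold f == mu]]
                   (permutations (transpose m (parts mu))).
  apply: uniq_perm; rewrite ?permutations_uniq ?map_inj_uniq ?enum_uniq // => s.
  rewrite mem_permutations; apply/mapP/idP => [[f]|ps].
    by rewrite mem_enum inE -perm_values // => pf ->.
  have size_s : size s = m by rewrite (perm_size ps) size_tuple.
  pose f := [ffun i : 'I_m => inord (nth 0%N s i) : 'I_4].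
  have fs : values f = s.
    apply: (@eq_from_nth _ 0%N) => [|i]; first by rewrite size_map size_enum_ord.
    rewrite size_map size_enum_ord => im.
    rewrite (nth_map (Ordinal im)) ?size_enum_ord // (nth_ord_enum _ (Ordinal im)) ffunE /=.
    rewrite inordK //.
    have : nth 0%N s i \in transpose m (parts mu).
      by rewrite -(perm_mem ps) mem_nth // size_s.
    case/mapP => i' _ ->; rewrite ltnS.
    by apply: leq_trans (count_size _ _) _; rewrite size_parts.
  by exists f => //; rewrite mem_enum inE -perm_values // fs.
rewrite /monsym -(perm_big _ perm_vals) /= big_map big_enum /=.
apply: eq_bigr => f _; rewrite mpolyXE_id; apply: eq_bigr => i _.
by rewrite mnmE (nth_map i) ?size_enum_ord // nth_ord_enum.
Qed.

(** Expand both products over exponent vectors; the second one carries the sign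
    (-1) to the number of exponents above 1, which is the second part of
    [threshold]. *)
Lemma sum_monsym m :
  2%:R^-1 *: (\prod_(i < m) ((1 + 'X_i) * (1 + 'X_i ^+ 2))
              - \prod_(i < m) ((1 + 'X_i) * (1 - 'X_i ^+ 2)))
    = \sum_(mu : 3.-tuple 'I_m.+1
              | is_part (parts mu) && odd (nth 0%N (parts mu) 1))
        monsym rat (transpose m (parts mu)).
Proof.
pose s2 (v : nat) : {mpoly rat[m]} := (-1) ^+ (1 < v)%N.
have -> : \prod_(i < m) ((1 + 'X_i) * (1 + 'X_i ^+ 2))
   = \sum_(f : {ffun 'I_m -> 'I_4}) \prod_(i < m) ('X_i ^+ f i : {mpoly rat[m]}).
  rewrite -(bigA_distr_bigA (fun (i : 'I_m) (v : 'I_4) => 'X_i ^+ v)).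
  apply: eq_bigr => i _.
  by rewrite !big_ord_recl big_ord0 /=; ring.
have -> : \prod_(i < m) ((1 + 'X_i) * (1 - 'X_i ^+ 2))
   = \sum_(f : {ffun 'I_m -> 'I_4}) \prod_(i < m) (s2 (f i) * 'X_i ^+ f i).
  rewrite -(bigA_distr_bigA (fun (i : 'I_m) (v : 'I_4) => s2 v * 'X_i ^+ v)).
  apply: eq_bigr => i _; rewrite !big_ord_recl big_ord0 /s2 /=; ring.
rewrite -sumrB.
under [RHS]eq_bigr => mu /andP[mup _] do rewrite monsymE //.
rewrite scaler_sumr.
transitivity (\sum_(f : {ffun 'I_m -> 'I_4} | odd (\sum_(i < m) (1 < f i))%N)
                \prod_(i < m) ('X_i ^+ f i : {mpoly rat[m]})).
  rewrite [RHS]big_mkcond; apply: eq_bigr => f _; rewrite big_split /=.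
  rewrite /s2 -expr_sum -signr_odd; case: (odd _) => /=.
    by rewrite expr1 mulN1r opprK -mulr2n -scaler_nat scalerA mulVf // scale1r.
  by rewrite expr0 mul1r subrr scaler0.
have odd_threshold (f : {ffun 'I_m -> 'I_4}) :
    nth 0%N (parts (threshold f)) 1 = (\sum_(i < m) (1 < f i))%N.
  by rewrite (nth_parts (threshold f) (lift ord0 ord0)) tnth_threshold.
rewrite (partition_big (@threshold m)
  (fun mu => is_part (parts mu) && odd (nth 0%N (parts mu) 1))) /=; last first.
  by move=> f fodd; rewrite threshold_part odd_threshold.
apply: eq_bigr => mu /andP[mup muodd]; apply: eq_bigl => f.
by case: eqP => [fmu|]; rewrite ?andbF // -odd_threshold fmu muodd.
Qed.

Theorem corollary4p18 (m : nat) (hm : (1 <= m)%N) :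
  2%:R^-1 *: (\prod_(i < m) ((1 + 'X_i) * (1 + 'X_i ^+ 2))
              - \prod_(i < m) ((1 + 'X_i) * (1 - 'X_i ^+ 2)))
    = \sum_(mu : 3.-tuple 'I_m.+1
              | is_part (parts mu) && odd (nth 0%N (parts mu) 1))
        monsym rat (transpose m (parts mu))
  /\
  \sum_(mu : 3.-tuple 'I_m.+1
          | is_part (parts mu) && odd (nth 0%N (parts mu) 1))
      monsym rat (transpose m (parts mu))
    = \sum_(la : m.-tuple 'I_4 | is_part (parts la))
        (let mu := transpose 3 (parts la) in
         let eps := mu_eps mu in
         let z := (mu_a mu - mu_b mu)%N in
         let b' := (mu_b mu - eps)%N in
         omega eps z b' *: schur rat m (parts la)).
Proof. by split; rewrite ?sum_omega_schur -sum_monsym. Qed.
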